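(* Let $n$ and $k$ be integers with $n\ge k+2$ and $k\ge 2$. Then the total mutual-visibility number of the Johnson graph $J(n,k)$ satisfies $$\mu_{\rm t}(J(n,k))=\mathrm{ex}_k(n,\mathcal C_4^{k+}),$$ where $\mathcal C_4^{k+}$ is the $k$-uniform suspension of the $4$-cycle.
   Context: Johnson graph: $J(n,k)$ has as vertices the $k$-element subsets of $[n]=\{1,\dots,n\}$; two vertices $A,B$ are adjacent if and only if $|A\cap B|=k-1$. Total mutual-visibility: Let $G$ be a connected graph and $\mathcal X\subseteq V(G)$. Two vertices $u,v\in V(G)$ are $\mathcal X$-visible if there is a shortest $u,v$-path $P$ in $G$ with no internal vertex in $\mathcal X$, i.e. $V(P)\cap\mathcal X\subseteq\{u,v\}$. The set $\mathcal X$ is a total mutual-visibility set if any two vertices of $V(G)$ are $\mathcal X$-visible. The total mutual-visibility number $\mu_{\rm t}(G)$ is the largest cardinality of a total mutual-visibility set in $G$. A hypergraph is $k$-uniform (a $k$-graph) if every edge consists of exactly $k$ vertices. The $k$-uniform suspension $\mathcal C_4^{k+}$ of the $4$-cycle ($k\ge 2$) is the $k$-graph on the $(k+2)$-element vertex set $Y\cup\{z_1,z_2,z_3,z_4\}$ (with $|Y|=k-2$, $Y$ disjoint from the four distinct vertices $z_i$) whose edges are the four sets $Y\cup\{z_1,z_2\}$, $Y\cup\{z_2,z_3\}$, $Y\cup\{z_3,z_4\}$, $Y\cup\{z_4,z_1\}$. Turán number: for a $k$-graph $\mathcal F$, $\mathrm{ex}_k(n,\mathcal F)$ is the maximum number of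 edges in a $k$-graph on $n$ vertices containing no (not necessarily induced) subhypergraph isomorphic to $\mathcal F$. *)

(* Defs.v *)
From mathcomp Require Import all_boot.
From mathcomp Require Import boolp.

Set Implicit Arguments.
Unset Strict Implicit.
Unset Printing Implicit Defensive.

Record sgraph := SGraph {
  vertex :> finType;
  adj : rel vertex;
  adj_sym : symmetric adj;
  adj_irr : irreflexive adj }.

(* The path with vertices u, p_1, ..., p_m is represented by u and
   p = [:: p_1; ...; p_m]; its length is size p. *)
Definition is_path (G : sgraph) (u v : G) (p : seq G) : bool :=
  [&& path (@adj G) u p, uniq (u :: p) & last u p == v].

Definition is_shortest_path (G : sgraph) (u v : G) (p : seq G) : Prop :=
  is_path u v p /\ forall q : seq G, is_path u v q -> size p <= size q.

Definition visible (G : sgraph) (X : {set G}) (u v : G) : Prop :=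
  exists p : seq G, is_shortest_path u v p /\
    forall x : G, x \in u :: p -> x \in X -> x = u \/ x = v.

(* If G is disconnected, no set qualifies, since some pairs of vertices are
   joined by no path at all. *)
Definition total_mutual_visibility_set (G : sgraph) (X : {set G}) : Prop :=
  forall u v : G, visible X u v.

Definition total_mutual_visibility_number (G : sgraph) : nat :=
  \max_(X : {set G} | `[< total_mutual_visibility_set X >]) #|X|.

Definition ksubset (n k : nat) : finType := {A : {set 'I_n} | #|A| == k}.

(* The condition #|A :&: B| = k - 1, written without truncated subtraction so
   that the relation is irreflexive for k = 0 too. *)
Definition johnson_adj (n k : nat) : rel (ksubset n k) :=
  fun A B => #|val A :&: val B|.+1 == k.

Lemma johnson_adj_sym (n k : nat) : symmetric (@johnson_adj n k).
Proof. by move=> A B; rewrite /johnson_adj setIC. Qed.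

Lemma johnson_adj_irr (n k : nat) : irreflexive (@johnson_adj n k).
Proof.
by move=> A; rewrite /johnson_adj setIid (eqP (valP A)) eqn_leq ltnn.
Qed.

Definition johnson (n k : nat) : sgraph :=
  SGraph (@johnson_adj_sym n k) (@johnson_adj_irr n k).

(* A hypergraph on the finite vertex type V is its set of edges. *)
Definition uniform (k : nat) (V : finType) (H : {set {set V}}) : bool :=
  [forall e in H, #|e| == k].

(* The image of F under the injection f is the (not necessarily induced)
   subhypergraph of H isomorphic to F. *)
Definition contains_copy (W V : finType) (F : {set {set W}})
    (H : {set {set V}}) : bool :=
  [exists f : {ffun W -> V},
     injectiveb f && ([set f @: (e : {set W}) | e in F] \subset H)].

Definition turan_number (k n : nat) (W : finType) (F : {set {set W}}) : nat :=
  \max_(H : {set {set 'I_n}} | uniform k H && ~~ contains_copy F H) #|H|.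

(* For k >= 2: Y is the left summand, the z_i form the right one, and
   ordS i = i + 1 modulo 4. *)
Definition C4_suspension (k : nat) : {set {set ('I_(k - 2) + 'I_4)%type}} :=
  [set [set inl y | y : 'I_(k - 2)] :|: [set inr i; inr (ordS i)] | i : 'I_4].

(* Main.v *)
Require Import Defs.
From mathcomp Require Import all_boot.
From mathcomp Require Import boolp zify.

Set Implicit Arguments.
Unset Strict Implicit.
Unset Printing Implicit Defensive.

(** Write [exchange A a b] for A - a + b.  When A has k elements, a1, a2 are
    distinct elements of A and b1, b2 distinct elements outside A, the four sets
    [exchange A ai bj] are exactly the common neighbours, in the Johnson graph,
    of A and of B = A - a1 - a2 + b1 + b2, which are at distance 2.  They are
    also the edges of a suspended 4-cycle: Y is the intersection of A and B, and
    the cycle is a1, b1, a2, b2.  Every copy of the suspended 4-cycle arises in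
    this way ([contains_C4_suspensionP]).

    So a copy inside X blocks all geodesics between A and B
    ([exchange_square_not_visible]).  Conversely, let X contain no copy and let
    A, B be at distance d, that is, |A \ B| = d.  If d >= 2, choose a1, a2 in
    A \ B and b1, b2 in B \ A: one of the exchanges [exchange A ai bj] is not in
    X, and it is at distance d - 1 from B.  Taking it as the first step and
    continuing by induction on d gives a geodesic whose internal vertices avoid X
    ([geodesic_avoiding]).  Hence the total mutual-visibility sets are exactly
    the k-graphs without a copy, and the two maxima agree. *)

(** * Exchanging one element of a set *)

Definition exchange (T : finType) (A : {set T}) (a b : T) : {set T} :=
  b |: A :\ a.

Lemma in_exchange (T : finType) (A : {set T}) (a b x : T) :
  (x \in exchange A a b) = (x == b) || (x != a) && (x \in A).
Proof. by rewrite !inE. Qed.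

Lemma card_exchange (T : finType) (A : {set T}) (a b : T) :
  a \in A -> b \notin A -> #|exchange A a b| = #|A|.
Proof.
by move=> aA bA; rewrite cardsU1 !inE (negbTE bA) andbF (cardsD1 a A) aA.
Qed.

Lemma imset_exchange (S T : finType) (f : S -> T) (A : {set S}) (a b : S) :
  injective f -> f @: exchange A a b = exchange (f @: A) (f a) (f b).
Proof.
move=> finj; apply/setP=> y; rewrite in_exchange; apply/imsetP/idP.
  case=> x; rewrite in_exchange => /orP[/eqP-> ->|/andP[xa xA] ->].
    by rewrite eqxx.
  by rewrite !(inj_eq finj) xa imset_f ?orbT.
case/orP=> [/eqP->|/andP[ya /imsetP[x xA yx]]].
  by exists b; rewrite // in_exchange eqxx.
exists x => //; rewrite in_exchange xA andbT.
by rewrite yx (inj_eq finj) in ya; rewrite ya orbT.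
Qed.

Lemma setD_exchangel (T : finType) (A : {set T}) (a b : T) :
  b \notin A -> a != b -> exchange A a b :\: A = [set b].
Proof.
move=> bA ab; apply/setP=> x; rewrite in_setD in_exchange in_set1.
case: (eqVneq x b) => [->|_] /=; first by rewrite bA.
by case: (x \in A); rewrite ?andbF.
Qed.

Lemma setD_exchange_towards (T : finType) (A B : {set T}) (a b : T) :
  b \in B -> exchange A a b :\: B = (A :\: B) :\ a.
Proof.
move=> bB; apply/setP=> x; rewrite !inE.
by case: (eqVneq x b) => [->|_] /=; rewrite ?bB ?andbF // andbCA.
Qed.

(** Sets of equal size differing by one element arise from each other by an
    exchange: both differences are singletons. *)
Lemma exchange_of_cardD1 (T : finType) (A C : {set T}) :
  #|A| = #|C| -> #|A :\: C| = 1 ->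
  exists a b, [/\ a \in A, b \notin A & C = exchange A a b].
Proof.
move=> cardAC AC1.
have CA1 : #|C :\: A| = 1.
  by move: AC1; rewrite !cardsD cardAC setIC.
have/eqP/cards1P[a ACa] := AC1; have/eqP/cards1P[b CAb] := CA1.
have aAC : a \in A :\: C by rewrite ACa set11.
have bCA : b \in C :\: A by rewrite CAb set11.
exists a, b; move: (aAC) (bCA); rewrite !in_setD => /andP[aC aA] /andP[bA bC].
split=> //; apply/setP=> x; rewrite in_exchange -!in_set1 -ACa -CAb !inE.
by case: (x \in A); case: (x \in C).
Qed.

(** A suspended 4-cycle a1, b1, a2, b2 of H with Y = A - a1 - a2, described from
    the set A that Y and the diagonal a1, a2 form together.  In this form its
    edges are candidate first steps of a geodesic leaving A. *)
Definition exchange_square (T : finType) (H : {set {set T}}) (A : {set T})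
    (a1 a2 b1 b2 : T) : Prop :=
  [/\ [/\ a1 \in A, a2 \in A & a1 != a2],
      [/\ b1 \notin A, b2 \notin A & b1 != b2],
      exchange A a1 b1 \in H /\ exchange A a1 b2 \in H &
      exchange A a2 b1 \in H /\ exchange A a2 b2 \in H].

(** * Copies of the suspended 4-cycle *)

Definition cycle_vertex (k : nat) (i : nat) : 'I_(k - 2) + 'I_4 :=
  inr (inord i).

Definition diagonal (k : nat) : {set 'I_(k - 2) + 'I_4} :=
  [set inl y | y : 'I_(k - 2)] :|: [set cycle_vertex k 0; cycle_vertex k 2].

Lemma mem_inl_imset (S T : finType) (x : S + T) :
  (x \in [set inl y | y : S]) = if x is inl _ then true else false.
Proof.
by case: x => x; [rewrite imset_f | apply/imsetP=> -[]].
Qed.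

Lemma eq_cycle_vertex (k i j : nat) :
  i < 4 -> j < 4 -> (cycle_vertex k i == cycle_vertex k j) = (i == j).
Proof.
move=> i4 j4; rewrite /cycle_vertex (inj_eq (@inr_inj _ _)) -val_eqE /=.
by rewrite !inordK.
Qed.

Lemma cycle_vertex_diagonal (k i : nat) :
  i < 4 -> (cycle_vertex k i \in diagonal k) = (i == 0) || (i == 2).
Proof. by move=> i4; rewrite !inE mem_inl_imset !eq_cycle_vertex. Qed.

(** On Y and z0, z1, z2, z3, the edge through zi and z(i+1) arises from the
    diagonal set Y + z0 + z2 by trading the even vertex that it misses for the
    odd one that it contains. *)
Lemma C4_suspensionE (k : nat) :
  let z := cycle_vertex k in
  C4_suspension k = [set exchange (diagonal k) (z 0) (z 1);
                         exchange (diagonal k) (z 0) (z 3);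
                         exchange (diagonal k) (z 2) (z 1);
                         exchange (diagonal k) (z 2) (z 3)].
Proof.
pose Y : {set 'I_(k - 2) + 'I_4} := [set inl y | y : 'I_(k - 2)].
pose edge i : {set 'I_(k - 2) + 'I_4} := Y :|: [set inr i; inr (ordS i)].
have edgeE i a b : i < 4 ->
    (a, b) = nth (0, 0) [:: (2, 1); (0, 1); (0, 3); (2, 3)] i ->
  edge (inord i) = exchange (diagonal k) (cycle_vertex k a) (cycle_vertex k b).
  move=> i4 abE; apply/setP=> x; rewrite in_exchange !inE !mem_inl_imset.
  case: x => [y|j] //=; rewrite /cycle_vertex !(inj_eq (@inr_inj _ _)) -!val_eqE /=.
  by case: i i4 abE => [|[|[|[|i]]]] //= _ [-> ->]; rewrite !inordK //;
    case: j => [[|[|[|[|j]]]]].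
move=> z; rewrite -(edgeE 1) // -(edgeE 2) // -(edgeE 0) // -(edgeE 3) //.
apply/setP=> e; apply/imsetP/idP => [[i _ ->]|].
  rewrite -/(edge i) !inE -[i]inord_val.
  by case: i => [[|[|[|[|i]]]] i4] //=; rewrite eqxx ?orbT.
by rewrite !inE -!orbA => /or4P[] /eqP->; [exists (inord 1) | exists (inord 2)
  | exists (inord 0) | exists (inord 3)].
Qed.

Lemma card_diagonal (k : nat) : 2 <= k -> #|diagonal k| = k.
Proof.
move=> k2; rewrite cardsU cards2 eq_cycle_vertex // card_imset; last exact: inl_inj.
rewrite card_ord (_ : _ :&: _ = set0) ?cards0; first by lia.
by apply/setP=> x; rewrite !inE mem_inl_imset; case: x.
Qed.

(** An injection is prescribed on the cycle by the square, and on Y by any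
    enumeration of A - a1 - a2, which has k - 2 elements. *)
Lemma square_embedding (k : nat) (T : finType) (A : {set T}) (a1 a2 b1 b2 : T) :
  #|A| = k -> [/\ a1 \in A, a2 \in A & a1 != a2] ->
  [/\ b1 \notin A, b2 \notin A & b1 != b2] ->
  exists f : 'I_(k - 2) + 'I_4 -> T,
    [/\ injective f, f @: diagonal k = A &
        [/\ f (cycle_vertex k 0) = a1, f (cycle_vertex k 1) = b1,
            f (cycle_vertex k 2) = a2 & f (cycle_vertex k 3) = b2]].
Proof.
move=> cardA [a1A a2A a12] [b1A b2A b12].
pose Y := A :\ a1 :\ a2.
have cardY : #|Y| = k - 2.
  have := cardsD1 a1 A; have := cardsD1 a2 (A :\ a1).
  by rewrite a1A !inE a2A eq_sym a12 cardA -/Y /=; lia.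
pose zs := [:: a1; b1; a2; b2].
have uniq_zs : uniq zs.
  have neq a b : a \in A -> b \notin A -> a != b.
    by move=> aA; apply: contraNneq => <-.
  by rewrite /= !inE !negb_or a12 b12 !(neq a1) // (eq_sym b1) !(neq a2).
(* The default value a1 is never reached: enum Y has k - 2 entries, zs has 4. *)
pose f (x : 'I_(k - 2) + 'I_4) :=
  match x with inl y => nth a1 (enum Y) y | inr i => nth a1 zs i end.
have fY y : f (inl y) \in Y.
  by rewrite -mem_enum mem_nth // -cardE cardY.
have fz i : f (inr i) \notin Y.
  by case: i => [[|[|[|[|i]]]] i4] //=; rewrite !inE /= ?eqxx ?(negbTE b1A)
    ?(negbTE b2A) ?andbF.
have finj : injective f.
  move=> [x|x] [y|y] /eqP fxy.
  - congr inl; apply/val_inj/eqP; move: fxy.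
    by rewrite nth_uniq ?enum_uniq // -cardE cardY.
  - by have := fY x; rewrite (eqP fxy) (negbTE (fz y)).
  - by have := fY y; rewrite -(eqP fxy) (negbTE (fz x)).
  - by congr inr; apply/val_inj/eqP; move: fxy; rewrite nth_uniq.
exists f; split=> //; last by rewrite /f /= !inordK.
apply/eqP; rewrite eqEcard card_imset // card_diagonal ?cardA ?leqnn ?andbT.
  apply/subsetP=> _ /imsetP[x xD ->]; move: xD; rewrite !inE mem_inl_imset.
  case: x => [y _|i] /=; first by have := fY y; rewrite !inE => /and3P[].
  by case/orP=> /eqP[->]; rewrite /= inordK.
by rewrite -cardA (cardsD1 a1) a1A (cardsD1 a2) !inE a2A eq_sym a12.
Qed.

Lemma contains_C4_suspensionP (k : nat) (T : finType) (H : {set {set T}}) :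
  2 <= k ->
  contains_copy (C4_suspension k) H <->
  exists (A : {set T}) a1 a2 b1 b2, #|A| = k /\ exchange_square H A a1 a2 b1 b2.
Proof.
move=> k2; split.
  case/existsP=> f /andP[/injectiveP finj /subsetP fH].
  pose z i := f (cycle_vertex k i).
  have edgeH a b :
      exchange (diagonal k) (cycle_vertex k a) (cycle_vertex k b)
        \in C4_suspension k ->
      exchange (f @: diagonal k) (z a) (z b) \in H.
    move=> eC; rewrite -imset_exchange //; apply: fH.
    exact: (imset_f (fun e : {set _} => f @: e)).
  exists (f @: diagonal k), (z 0), (z 2), (z 1), (z 3).
  rewrite card_imset ?card_diagonal //; split=> //.
  rewrite /exchange_square !mem_imset ?cycle_vertex_diagonal //.
  rewrite !(inj_eq finj) !eq_cycle_vertex //.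
  by split=> //; split; apply: edgeH; rewrite C4_suspensionE !inE eqxx ?orbT.
case=> A [a1 [a2 [b1 [b2 [cardA [Aa Ab [e11 e12] [e21 e22]]]]]]].
have [f [finj fA [f0 f1 f2 f3]]] := square_embedding cardA Aa Ab.
apply/existsP; exists (finfun f); apply/andP; split.
  by apply/injectiveP=> x y; rewrite !ffunE; apply: finj.
apply/subsetP=> _ /imsetP[e eC ->].
rewrite (eq_imset (g := f) e (ffunE f)); move: eC.
rewrite C4_suspensionE !inE -!orbA.
by case/or4P=> /eqP->; rewrite imset_exchange // fA ?f0 ?f1 ?f2 ?f3.
Qed.

(** * Geodesics in the Johnson graph *)

Lemma card_ksubset (n k : nat) (A : ksubset n k) : #|val A| = k.
Proof. exact/eqP/(valP A). Qed.

Lemma johnson_adjE (n k : nat) (A B : ksubset n k) :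
  johnson_adj A B = (#|val A :\: val B| == 1).
Proof.
rewrite cardsD card_ksubset /johnson_adj.
have := subset_leq_card (subsetIl (val A) (val B)); rewrite card_ksubset.
by move: #|_ :&: _| => m; lia.
Qed.

Lemma ksubset_eq_cardD0 (n k : nat) (A B : ksubset n k) :
  #|val A :\: val B| = 0 -> A = B.
Proof.
move/eqP; rewrite cards_eq0 setD_eq0 => AB; apply/val_inj/eqP.
by rewrite eqEcard AB !card_ksubset /=.
Qed.

Lemma ksubset_exchange (n k : nat) (A : ksubset n k) (a b : 'I_n) :
  a \in val A -> b \notin val A ->
  exists A' : ksubset n k, val A' = exchange (val A) a b.
Proof.
move=> aA bA.
have eA : #|exchange (val A) a b| == k by rewrite card_exchange // card_ksubset.
by exists (Sub (exchange (val A) a b) eA); rewrite SubK.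
Qed.

(** Each step of a path replaces a single element. *)
Lemma cardD_last_le_size (n k : nat) (A : johnson n k) (p : seq (johnson n k)) :
  path (@adj (johnson n k)) A p -> #|val A :\: val (last A p)| <= size p.
Proof.
elim: p A => [|C p IH] A; first by rewrite /= setDv cards0.
rewrite /= johnson_adjE => /andP[/eqP AC /IH Cp] /=.
rewrite -add1n -AC; apply: leq_trans (leq_add (leqnn _) Cp).
apply: leq_trans (leq_card_setU _ _); apply: subset_leq_card.
by apply/subsetP=> x; rewrite !inE; do 3!case: (x \in _).
Qed.

(** Only a walk is needed: one of length |A \ B| is as short as possible, and
    deleting its cycles makes it a path and only removes vertices. *)
Lemma visible_of_walk (n k : nat) (X : {set johnson n k}) (A B : johnson n k)
    (p : seq (johnson n k)) :
  path (@adj (johnson n k)) A p -> last A p = B ->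
  size p <= #|val A :\: val B| ->
  (forall C, C \in p -> C \in X -> C = B) ->
  visible X A B.
Proof.
move=> Ap pB szp pX.
case: (shortenP Ap) pB => q Aq uq qp qB.
have szq : size q <= size p by apply: uniq_leq_size qp; case/andP: uq.
exists q; split; last first.
  by move=> C; rewrite inE => /orP[/eqP|/qp/pX CX /CX]; [left | right].
split=> [|r /and3P[Ar _ /eqP rB]]; first by rewrite /is_path Aq uq qB eqxx.
by apply: leq_trans szq (leq_trans szp _); rewrite -rB cardD_last_le_size.
Qed.

Lemma geodesic_avoiding (n k : nat) (H : {set {set 'I_n}}) (B : johnson n k) :
  (forall (A : {set _}) a1 a2 b1 b2, #|A| = k -> ~ exchange_square H A a1 a2 b1 b2) ->
  forall A : johnson n k, exists p : seq (johnson n k),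
    [/\ path (@adj (johnson n k)) A p, last A p = B,
        size p = #|val A :\: val B| &
        forall C, C \in p -> val C \in H -> C = B].
Proof.
move=> noH A; move Ed: #|val A :\: val B| => d.
elim: d A Ed => [|d IH] A Ed.
  by exists [::]; rewrite /= (ksubset_eq_cardD0 Ed).
have [d0|d_gt0] := posnP d.
  exists [:: B]; rewrite /= johnson_adjE Ed d0; split=> // C.
  by rewrite inE => /eqP.
have [a1 [a2 [a1AB a2AB a12]]] : exists a1 a2,
    [/\ a1 \in val A :\: val B, a2 \in val A :\: val B & a1 != a2].
  by apply/card_gt1P; rewrite Ed ltnS.
have [b1 [b2 [b1BA b2BA b12]]] : exists b1 b2,
    [/\ b1 \in val B :\: val A, b2 \in val B :\: val A & b1 != b2].
  apply/card_gt1P; move: Ed.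
  by rewrite !cardsD !card_ksubset setIC => ->; rewrite ltnS.
have [a [b [aAB bBA abH]]] : exists a b,
    [/\ a \in val A :\: val B, b \in val B :\: val A &
        exchange (val A) a b \notin H].
  apply: contrapT => noab.
  have inH a b : a \in val A :\: val B -> b \in val B :\: val A ->
      exchange (val A) a b \in H.
    by move=> aAB bBA; apply: contrapT => /negP abH; apply: noab; exists a, b.
  apply: (noH (val A) a1 a2 b1 b2); first exact: card_ksubset.
  split; [| |by split; apply: inH|by split; apply: inH].
    by move: a1AB a2AB; rewrite !inE => /andP[_ ->] /andP[_ ->].
  by move: b1BA b2BA; rewrite !inE => /andP[-> _] /andP[-> _].
move: (aAB) (bBA); rewrite !in_setD => /andP[aB aA] /andP[bA bB].
have [C CE] := ksubset_exchange aA bA.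
have CB : #|val C :\: val B| = d.
  rewrite CE setD_exchange_towards //; move: (cardsD1 a (val A :\: val B)).
  by rewrite aAB Ed; case.
have [p [Cp pB szp pH]] := IH C CB.
have ab : a != b by apply: contraNneq bA => <-.
exists (C :: p); split=> //=; last 1 first.
- move=> D; rewrite inE => /orP[/eqP->|]; last exact: pH.
  by rewrite CE (negbTE abH).
- rewrite Cp andbT johnson_adj_sym.
  by rewrite johnson_adjE CE setD_exchangel ?cards1.
- by rewrite szp.
Qed.

(** * Total mutual-visibility sets *)

(** Put B = A - a1 - a2 + b1 + b2.  A geodesic from A to B has a single internal
    vertex C, which differs from B in one element only.  Writing
    C = [exchange A a b], this forces a to be a1 or a2 and b to be b1 or b2,
    since otherwise two elements among a1, a2, b lie in C and not in B. *)
Lemma exchange_square_not_visible (n k : nat) (H : {set {set 'I_n}})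
    (A : johnson n k) (a1 a2 b1 b2 : 'I_n) :
  exchange_square H (val A) a1 a2 b1 b2 ->
  exists B : johnson n k, ~ visible [set C : johnson n k | val C \in H] A B.
Proof.
case=> [[a1A a2A a12] [b1A b2A b12] [e11 e12] [e21 e22]].
have neq a b : a \in val A -> b \notin val A -> a != b.
  by move=> aA; apply: contraNneq => <-.
have [M ME] := ksubset_exchange a1A b1A.
have a2M : a2 \in val M by rewrite ME in_exchange (eq_sym a2 a1) a12 a2A orbT.
have b2M : b2 \notin val M.
  by rewrite ME in_exchange negb_or eq_sym b12 (negbTE b2A) andbF.
have [B BE] := ksubset_exchange a2M b2M.
have inB x : (x \in val B) =
    (x == b2) || (x != a2) && ((x == b1) || (x != a1) && (x \in val A)).
  by rewrite BE in_exchange ME in_exchange.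
have a1B : a1 \notin val B.
  by rewrite inB eqxx (negbTE (neq a1 b1 _ _)) // (negbTE (neq a1 b2 _ _)) // andbF.
have a2B : a2 \notin val B by rewrite inB eqxx (negbTE (neq a2 b2 _ _)).
have AM : johnson_adj A M.
  by rewrite johnson_adj_sym johnson_adjE ME setD_exchangel ?neq ?cards1.
have MB : johnson_adj M B.
  rewrite johnson_adj_sym johnson_adjE BE setD_exchangel ?cards1 //.
  exact: neq.
have AB1 : 1 < #|val A :\: val B|.
  by apply/card_gt1P; exists a1, a2; rewrite !in_setD a1B a2B a12.
exists B => -[p [[/and3P[Ap up /eqP pB] pmin] pX]].
have szp : size p = 2.
  apply/eqP; rewrite eqn_leq; apply/andP; split; last first.
    by apply: leq_trans AB1 _; rewrite -pB cardD_last_le_size.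
  apply: (pmin [:: M; B]); rewrite /is_path /= AM MB /= eqxx andbT.
  rewrite !inE negb_or andbT; apply/andP; split.
  - apply/andP; split; first by apply: contraTneq AM => ->; rewrite johnson_adj_irr.
    by apply: contraTneq AB1 => ->; rewrite setDv cards0.
  - by apply: contraTneq MB => ->; rewrite johnson_adj_irr.
case: p szp Ap up pB pX {pmin} => [|C [|D []]] //= _ /and3P[AC CB _] _ DB pX.
rewrite {D}DB in CB pX.
move: (AC) (CB); rewrite !johnson_adjE => /eqP AC1 /eqP CB1.
have [a [b [aA bA CE]]] : exists a b,
    [/\ a \in val A, b \notin val A & val C = exchange (val A) a b].
  by apply: exchange_of_cardD1 AC1; rewrite !card_ksubset.
have uniqCB x y : x \in val C -> x \notin val B ->
    y \in val C -> y \notin val B -> x = y.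
  move=> xC xB yC yB; have/eqP/cards1P[z CBz] := CB1.
  have eqz w : w \in val C -> w \notin val B -> w = z.
    by move=> wC wB; apply/set1P; rewrite -CBz in_setD wB.
  by rewrite (eqz x xC xB) (eqz y yC yB).
have inC x : x \in val A -> x != a -> x \in val C.
  by move=> xA xa; rewrite CE in_exchange xa xA orbT.
have bC : b \in val C by rewrite CE in_exchange eqxx.
have aE : (a == a1) || (a == a2).
  apply: contraNT a12; rewrite negb_or => /andP[aa1 aa2].
  by apply/eqP/uniqCB; rewrite ?inC // eq_sym.
have bE : (b == b1) || (b == b2).
  apply: contraT; rewrite negb_or => /andP[bb1 bb2].
  have bB : b \notin val B by rewrite inB (negbTE bb1) (negbTE bb2) (negbTE bA) !andbF.
  have [x xA [xa xB]] : exists2 x, x \in val A & x != a /\ x \notin val B.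
    by case/orP: aE => /eqP->; [exists a2 | exists a1]; rewrite // eq_sym.
  have /eqP[] := neq x b xA bA; exact: uniqCB (inC x xA xa) xB bC bB.
have CX : C \in [set D : johnson n k | val D \in H].
  rewrite inE [X in X \in H]CE.
  by case/orP: aE => /eqP->; case/orP: bE => /eqP->.
have [|CA|CB'] := pX C _ CX; first by rewrite !inE eqxx orbT.
  by move: AC1; rewrite CA setDv cards0.
by move: CB1; rewrite CB' setDv cards0.
Qed.

Lemma total_mutual_visibility_setP (n k : nat) (H : {set {set 'I_n}}) :
  2 <= k ->
  total_mutual_visibility_set [set A : johnson n k | val A \in H] <->
  ~ contains_copy (C4_suspension k) H.
Proof.
move=> k2; rewrite contains_C4_suspensionP //; split.
  move=> visH [A [a1 [a2 [b1 [b2 [/eqP cardA sq]]]]]].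
  have [B] := @exchange_square_not_visible n k H (Sub A cardA) a1 a2 b1 b2 sq.
  exact.
move=> noH A B.
have [|p [Ap pB szp pH]] := @geodesic_avoiding n k H B _ A.
  by move=> A' a1 a2 b1 b2 cardA' sq; apply: noH; exists A', a1, a2, b1, b2.
apply: (visible_of_walk Ap pB); first by rewrite szp.
by move=> C Cp; rewrite inE; apply: pH.
Qed.

Theorem theorem11 (n k : nat) (hn : k + 2 <= n) (hk : 2 <= k) :
  total_mutual_visibility_number (johnson n k)
  = turan_number k n (C4_suspension k).
Proof.
apply/eqP; rewrite eqn_leq; apply/andP; split; apply/bigmax_leqP.
  move=> X /asboolP visX; pose H := [set val A | A in X].
  have XE : [set A : johnson n k | val A \in H] = X.
    by apply/setP=> A; rewrite inE mem_imset //; apply: val_inj.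
  rewrite -(card_imset X val_inj) -/H.
  apply: (@leq_bigmax_cond _ _ (fun H : {set {set 'I_n}} => #|H|)).
  apply/andP; split.
    by apply/forallP=> e; apply/implyP=> /imsetP[A _ ->]; rewrite card_ksubset.
  by apply/negP; apply/(total_mutual_visibility_setP H hk); rewrite XE.
move=> H /andP[/forallP unifH /negP noH].
pose X := [set A : johnson n k | val A \in H].
have HE : [set val A | A in X] = H.
  apply/setP=> e; apply/imsetP/idP=> [[A AX ->]|eH]; first by rewrite inE in AX.
  have ek : #|e| == k by have /implyP := unifH e; apply.
  by exists (Sub e ek : ksubset n k); rewrite ?inE SubK.
rewrite -HE (card_imset X val_inj).
apply: (@leq_bigmax_cond _ _ (fun X : {set johnson n k} => #|X|)).
by apply/asboolP/total_mutual_visibility_setP.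
Qed.
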